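(* If $R$ is a central reduced ring, then $R$ is directly finite.
   Context: All rings are associative with identity, not necessarily commutative. A ring $R$ is called central reduced if every nilpotent element of $R$ is central. A ring $R$ is called directly finite if whenever $a,b\in R$, $ab=1$ implies $ba=1$. *)

(* Defs.v *)
From mathcomp Require Import all_boot all_algebra.

Set Implicit Arguments.
Unset Strict Implicit.
Unset Printing Implicit Defensive.

Import GRing.Theory.
Local Open Scope ring_scope.

(* [pzRingType] is the class of associative unital rings, not necessarily
   commutative and with the zero ring allowed. *)

Definition nilpotent_elt (R : pzRingType) (x : R) : Prop :=
  exists n : nat, (0 < n)%N /\ x ^+ n = 0.

Definition central_elt (R : pzRingType) (x : R) : Prop :=
  forall y : R, GRing.comm x y.

Definition central_reduced (R : pzRingType) : Prop :=
  forall x : R, nilpotent_elt x -> central_elt x.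

Definition directly_finite (R : pzRingType) : Prop :=
  forall a b : R, a * b = 1 -> b * a = 1.

(* Main.v *)
(* If a b = 1, then f = 1 - b a satisfies a f = 0 = f b, so x = f a squares to
   zero and is therefore central. Hence f = f a b = x b = b x = b f a, and
   multiplying by the idempotent f on the left gives f = f b f a = 0. *)
Require Import Defs.
From mathcomp Require Import all_boot all_algebra.

Import GRing.Theory.
Local Open Scope ring_scope.

Theorem corollary2p19 (R : pzRingType) :
  central_reduced R -> directly_finite R.
Proof.
move=> redR a b ab1.
pose f := 1 - b * a.
have af0 : a * f = 0 by rewrite mulrBr mulr1 mulrA ab1 mul1r subrr.
have fb0 : f * b = 0 by rewrite mulrBl mul1r -mulrA ab1 mulr1 subrr.
(* Only the left factor is expanded: [(1 - b * a) * f] is [f - b * (a * f)], and [af0] kills the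
   second term. *)
have ff : f * f = f by rewrite {1}/f mulrBl mul1r -mulrA af0 mulr0 subr0.
have x_central : central_elt (f * a).
  by apply: redR; exists 2; rewrite expr2 mulrA -(mulrA f a f) af0 mulr0 mul0r.
(* Centrality, taken at [b] and read from right to left, brings [b] next to [a], where [ab1] cancels
   the pair. *)
have fE : f = b * (f * a) by rewrite -x_central -mulrA ab1 mulr1.
(* Writing [f] as [f * f] and expanding only the right copy by [fE] leaves an [f] to annihilate the
   leading [b]. *)
have f0 : f = 0 by rewrite -ff {2}fE mulrA fb0 mul0r.
by apply/esym/eqP; rewrite -subr_eq0 -/f f0.
Qed.
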